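(* There exists a weak S-homotopy equivalence of flows $f:X\longrightarrow Y$ such that the topological spaces $\mathbb{P}^-X$ and $\mathbb{P}^-Y$ are not weakly homotopy equivalent.
   Context: All spaces are compactly generated topological spaces (weak Hausdorff $k$-spaces). A flow $X$ consists of a compactly generated space $\mathbb{P}X$ (the path space), a discrete space $X^0$ (the set of states), continuous maps $s,t:\mathbb{P}X\to X^0$, and a continuous associative map $*:\{(x,y)\in\mathbb{P}X\times\mathbb{P}X;\ t(x)=s(y)\}\to\mathbb{P}X$ with $s(x*y)=s(x)$ and $t(x*y)=t(y)$. A morphism of flows $f:X\to Y$ consists of a set map $f^0:X^0\to Y^0$ and a continuous map $\mathbb{P}f:\mathbb{P}X\to\mathbb{P}Y$ compatible with $s$, $t$ and $*$. It is a weak S-homotopy equivalence if $f^0$ is a bijection and $\mathbb{P}f$ is a weak homotopy equivalence. The branching space $\mathbb{P}^-X$ of a flow $X$ is the compactly generated space equipped with a continuous map $h^-:\mathbb{P}X\to\mathbb{P}^-X$ that is universal among continuous maps $\phi$ from $\mathbb{P}X$ to compactly generated spaces with $\phi(x)=\phi(x*y)$ whenever $t(x)=s(y)$ (it is the quotient of $\mathbb{P}X$ by the smallest equivalence relation with closed graph identifying $x$ with $x*y$). *)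

(* Defs.v *)
From Stdlib Require Import Relations.
From HB Require Import structures.
From mathcomp Require Import all_boot all_order all_algebra.
From mathcomp Require Import all_classical all_reals all_analysis.
Import Order.TTheory GRing.Theory Num.Theory.
Import numFieldNormedType.Exports.

Set Implicit Arguments.
Unset Strict Implicit.
Unset Printing Implicit Defensive.

Local Open Scope classical_set_scope.
Local Open Scope ring_scope.

(** * Compactly generated spaces *)

Definition k_open (T : topologicalType) (U : set T) : Prop :=
  forall (K : topologicalType) (u : K -> T),
    compact [set: K] -> hausdorff_space K -> continuous u ->
    open (u @^-1` U).

Definition k_space (T : topologicalType) : Prop :=
  forall U : set T, k_open U -> open U.

Definition weak_hausdorff (T : topologicalType) : Prop :=
  forall (K : topologicalType) (u : K -> T),
    compact [set: K] -> hausdorff_space K -> continuous u ->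
    closed (range u).

Record cgType := CGType {
  cg_sort :> topologicalType;
  cg_k_space : k_space cg_sort;
  cg_weak_hausdorff : weak_hausdorff cg_sort
}.

(** The k-ification of [T]: same points, with the k-open sets as open sets. *)
Definition kify (T : topologicalType) : Type := T.

Section kify_topology.
Variable T : topologicalType.

Let k_openT : k_open [set: T].
Proof. by move=> K u _ _ _; rewrite preimage_setT; exact: openT. Qed.

Let k_openI : setI_closed (@k_open T).
Proof.
move=> A B oA oB K u cK hK cu; rewrite preimage_setI.
by apply: openI; [exact: oA | exact: oB].
Qed.

Let k_open_bigU (I : Type) (F : I -> set T) :
  (forall i, k_open (F i)) -> k_open (\bigcup_i F i).
Proof.
move=> oF K u cK hK cu; rewrite preimage_bigcup.
by apply: bigcup_open => i _; exact: oF.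
Qed.

HB.instance Definition _ := Choice.on (kify T).
HB.instance Definition _ :=
  isOpenTopological.Build (kify T) k_openT k_openI k_open_bigU.

End kify_topology.

(** * Weak homotopy equivalences

  Maps out of the cube [0,1]^n are represented by functions defined on the
  whole of R^n; only their restriction to the cube is ever relevant. *)

Section weak_homotopy.
Variable R : realType.

Definition joined (X : topologicalType) (x y : X) : Prop :=
  exists c : R -> X,
    [/\ {within `[0, 1], continuous c}, c 0 = x & c 1 = y].

Definition cube (n : nat) : set 'rV[R]_n :=
  [set v | forall i, 0 <= v ord0 i <= 1].

Definition cube_boundary (n : nat) : set 'rV[R]_n :=
  [set v | cube v /\ exists i, v ord0 i = 0 \/ v ord0 i = 1].

(** The maps ([0,1]^n, boundary) -> (X, x), whose homotopy classes relative to
  the boundary are the elements of pi_n(X, x). *)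
Definition spheroid (n : nat) (X : topologicalType) (x : X)
    (a : 'rV[R]_n -> X) : Prop :=
  {within @cube n, continuous a} /\
  (forall v, cube_boundary v -> a v = x).

Definition spheroid_homotopic (n : nat) (X : topologicalType) (x : X)
    (a b : 'rV[R]_n -> X) : Prop :=
  exists H : R * 'rV[R]_n -> X,
    [/\ {within `[0, 1] `*` @cube n, continuous H},
        (forall v, cube v -> H (0, v) = a v),
        (forall v, cube v -> H (1, v) = b v) &
        (forall t v, 0 <= t <= 1 -> cube_boundary v -> H (t, v) = x)].

(** The maps induced on pi_n for n >= 1 are group homomorphisms, so they are
  isomorphisms as soon as they are bijective. *)
Record weak_homotopy_equivalence (X Y : topologicalType) (f : X -> Y) : Prop :=
  WeakHomotopyEquivalence {
  whe_continuous : continuous f;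
  whe_pi0_inj : forall x x', joined (f x) (f x') -> joined x x';
  whe_pi0_surj : forall y, exists x, joined (f x) y;
  whe_pin_inj : forall (n : nat) (x : X) (a b : 'rV[R]_n -> X), (0 < n)%N ->
    spheroid x a -> spheroid x b ->
    spheroid_homotopic (f x) (f \o a) (f \o b) -> spheroid_homotopic x a b;
  whe_pin_surj : forall (n : nat) (x : X) (b : 'rV[R]_n -> Y), (0 < n)%N ->
    spheroid (f x) b ->
    exists2 a : 'rV[R]_n -> X,
      spheroid x a & spheroid_homotopic (f x) (f \o a) b
}.

(** Connected by a finite zigzag of weak homotopy equivalences. *)
Definition weakly_homotopy_equivalent : cgType -> cgType -> Prop :=
  clos_refl_sym_trans cgType
    (fun X Y => exists f : X -> Y, weak_homotopy_equivalence f).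

End weak_homotopy.

(** * Flows *)

Definition composable (P : topologicalType) (S : Type) (s t : P -> S) :
    set (P * P) :=
  [set p | t p.1 = s p.2].

Lemma composableP (P : topologicalType) (S : Type) (s t : P -> S)
  (p : composable s t) : t (val p).1 = s (val p).2.
Proof. exact: set_mem (valP p). Qed.

(** The space of composable pairs is the fibre product in compactly generated
  spaces, i.e. the k-ification of the subspace of the product. *)
Record flow := Flow {
  paths : cgType;
  states : discreteTopologicalType;
  src : paths -> states;
  tgt : paths -> states;
  pcomp : forall x y : paths, tgt x = src y -> paths;
  src_continuous : continuous src;
  tgt_continuous : continuous tgt;
  pcomp_continuous : continuous
    (fun p : kify (composable src tgt) => pcomp (composableP p));
  src_pcomp : forall x y (h : tgt x = src y), src (pcomp h) = src x;
  tgt_pcomp : forall x y (h : tgt x = src y), tgt (pcomp h) = tgt y;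
  pcompA : forall x y z (hxy : tgt x = src y) (hyz : tgt y = src z)
    (hl : tgt (pcomp hxy) = src z) (hr : tgt x = src (pcomp hyz)),
    pcomp hl = pcomp hr
}.

Record flow_morphism (X Y : flow) := FlowMorphism {
  on_states : states X -> states Y;
  on_paths : paths X -> paths Y;
  on_paths_continuous : continuous on_paths;
  on_paths_src : forall x, src (on_paths x) = on_states (src x);
  on_paths_tgt : forall x, tgt (on_paths x) = on_states (tgt x);
  on_paths_pcomp : forall x y (h : tgt x = src y)
    (h' : tgt (on_paths x) = src (on_paths y)),
    on_paths (pcomp h) = pcomp h'
}.

Definition weak_S_homotopy_equivalence (R : realType) (X Y : flow)
    (f : flow_morphism X Y) : Prop :=
  bijective (on_states f) /\ weak_homotopy_equivalence R (on_paths f).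

(** * Branching spaces *)

Definition branching_compatible (X : flow) (Z : Type) (phi : paths X -> Z) :
    Prop :=
  forall x y (h : tgt x = src y), phi x = phi (pcomp h).

(** [(B, h)] is the branching space of [X]; it is determined up to a unique
  homeomorphism by this universal property. *)
Record is_branching_space (X : flow) (B : cgType) (h : paths X -> B) : Prop :=
  IsBranchingSpace {
  branching_continuous : continuous h;
  branching_compat : branching_compatible h;
  branching_universal : forall (Z : cgType) (phi : paths X -> Z),
    continuous phi -> branching_compatible phi ->
    exists! g : B -> Z, continuous g /\ g \o h = phi
}.

(* Main.v *)
(** Take a semigroup [M = {0} + {1, 2, ...} + {oo}] as the path space of a flow
  with one state, [None] playing the role of [oo]. The product [x * y] is
  [r_i x] with [i] telling whether [y = 0], where [r_0, r_1] are the two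
  retractions sending a positive even number to a neighbouring odd number, and
  fixing [0], [oo] and the odd numbers. The relation [x ~ x * y] then links each
  even number to both its neighbours, so that its classes are [{0}],
  [{1, 2, ...}] and [{oo}].
  Give [M] first the discrete topology, then that of the one-point
  compactification of the natural numbers. Both are totally disconnected, hence
  the identity is a weak homotopy equivalence. The branching space of the former
  flow is the discrete set of the three classes; in the latter, the closed-graph
  condition merges [oo] with [{1, 2, ...}] and only two points remain. The
  number of path components tells them apart. *)

Require Import Defs.
From mathcomp Require Import all_boot all_order all_algebra.
From mathcomp Require Import all_classical all_reals all_analysis.
From mathcomp Require Import lra.
Import Order.TTheory GRing.Theory Num.Theory.
Import numFieldNormedType.Exports.
Set Implicit Arguments.
Unset Strict Implicit.
Unset Printing Implicit Defensive.
Local Open Scope classical_set_scope.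
Local Open Scope ring_scope.

(** * Separation and compact generation *)

Lemma zero_dimensional_hausdorff (T : topologicalType) :
  zero_dimensional T -> hausdorff_space T.
Proof.
move=> T0; rewrite open_hausdorff => x y /T0[U [[oU cU] Ux nUy]].
exists (U, ~` U); split; rewrite ?inE//=; first exact: closed_openC.
by rewrite setICr.
Qed.

Lemma zero_dimensional_connected (T : topologicalType) (A : set T) (x y : T) :
  zero_dimensional T -> connected A -> A x -> A y -> x = y.
Proof.
move=> /zero_dimension_totally_disconnected/(_ x Logic.I) Tx cA Ax Ay.
suff : [set x] y by [].
by rewrite -Tx; apply: (connected_component_max (B := A)).
Qed.

Lemma hausdorff_weak_hausdorff (T : topologicalType) :
  hausdorff_space T -> weak_hausdorff T.
Proof.
move=> hT K u cK _ cu; apply: compact_closed => //.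
by apply: continuous_compact => //; exact: continuous_subspaceT.
Qed.

Lemma compact_hausdorff_k_space (T : topologicalType) :
  compact [set: T] -> hausdorff_space T -> k_space T.
Proof. by move=> cT hT U /(_ T id cT hT); apply=> x. Qed.

Lemma discrete_k_space (T : discreteTopologicalType) : k_space T.
Proof. by move=> U _; exact: discrete_open. Qed.

Lemma discrete_continuous (D : discreteTopologicalType) (T : topologicalType)
  (f : D -> T) : continuous f.
Proof.
move=> x U /nbhs_singleton fxU.
by rewrite nbhs_principalE; apply/principal_filterP.
Qed.

Definition discrete_cg (T : choiceType) : cgType :=
  CGType (@discrete_k_space (discrete_topology T))
    (hausdorff_weak_hausdorff discrete_hausdorff).

(** A point is the image of a one-point compact space. Closedness of points is what the closed-graph
    condition on the branching space comes down to here. *)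
Lemma weak_hausdorff_closed1 (T : topologicalType) (x : T) :
  weak_hausdorff T -> closed [set x].
Proof.
move=> /(_ (discrete_topology unit) (fun=> x)) wT.
have -> : [set x] = range (fun _ : discrete_topology unit => x).
  by apply/seteqP; split => [_ ->|_ [_ _ <-]//]; exists tt.
apply: (wT _ (@discrete_hausdorff _) (@cst_continuous _ _ _)).
by apply: finite_compact; exact: finite_finset.
Qed.

(** * Topological semigroups as flows with one state *)

Lemma kify_continuous (T U : topologicalType) (f : T -> U) :
  continuous f -> continuous (f : kify T -> U).
Proof.
move=> /continuousP cf; apply/continuousP => A /cf oA.
suff : k_open (f @^-1` A) by [].
by move=> K u cK hK /continuousP; exact.
Qed.

Lemma semigroup_flow_continuous (P : cgType) (S : Type) (s t : P -> S) 
    (m : P -> P -> P) :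
  continuous (fun p : P * P => m p.1 p.2) ->
  continuous (fun p : kify (composable s t) => m (val p).1 (val p).2).
Proof.
move=> cm; apply: kify_continuous => x.
have cval : continuous (val : composable s t -> P * P).
  exact: initial_continuous.
exact: (continuous_comp (cval x) (cm (val x))).
Qed.

Definition semigroup_flow (P : cgType) (m : P -> P -> P)
    (cm : continuous (fun p : P * P => m p.1 p.2))
    (mA : associative m) : flow :=
  @Flow P (discrete_topology unit) (fun=> tt) (fun=> tt) (fun x y _ => m x y)
    (@cst_continuous _ (discrete_topology unit) tt)
    (@cst_continuous _ (discrete_topology unit) tt)
    (semigroup_flow_continuous cm)
    (fun _ _ _ => erefl) (fun _ _ _ => erefl)
    (fun x y z _ _ _ _ => esym (mA x y z)).

(** * The one-point compactification of the natural numbers *)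

Local Notation natoo := (one_point_compactification nat).

Lemma nbhs_infty (U : set natoo) :
  nbhs (None : natoo) U <-> U None /\ \forall n \near \oo, U (Some n).
Proof.
split=> [[C [cC _] CU]|[UN [N _ NU]]].
- split; first by apply: CU; right.
  (* A compact set of naturals is bounded: each point has a strict upper bound valid on a
     neighbourhood, and compactness makes it uniform. *)
  have /compact_near_coveringP/(_ nat \oo (fun i x => x < i)%N) := cC.
  case=> [x Cx|N _ NC].
    exists ([set x], [set i | (x < i)%N]).
      by split; [exact: discrete_set1|exists x.+1].
    by case=> [y i] [/= -> ?].
  exists N => // n Nn; apply: CU; left; exists n => // /(NC n Nn) /=.
  by rewrite ltnn.
- exists `I_N.
    by split; [apply: finite_compact; exact: finite_II|exact: discrete_closed].
  move=> _ [[n /= nN <-]|-> //]; apply: NU => /=.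
  by rewrite leqNgt; apply/negP.
Qed.

Lemma nbhs_Some (n : nat) (U : set natoo) :
  U (Some n) -> nbhs (Some n : natoo) U.
Proof.
move=> Un; apply: (@filterS natoo (nbhs (Some n : natoo)) _ (Some @` [set n])).
  by move=> _ [_ -> <-].
exact/one_point_compactification_some_nbhs/discrete_set1.
Qed.

Lemma natoo_continuous (T : topologicalType) (f : natoo -> T) :
  {for None, continuous f} -> continuous f.
Proof. by move=> fN [n|//] U /nbhs_singleton Ufn; exact: nbhs_Some. Qed.

Lemma clopen_Some (n : nat) : clopen [set (Some n : natoo)].
Proof.
split.
  rewrite -image_set1.
  exact/one_point_compactification_open_some/discrete_open.
rewrite -[X in closed X]setCK; apply: open_closedC; rewrite openE => -[m mn|_].
  exact: nbhs_Some.
apply/nbhs_infty; split => //; exists n.+1 => // m /= nm [mn].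
by rewrite mn ltnn in nm.
Qed.

Lemma natoo_zero_dimensional : zero_dimensional natoo.
Proof.
move=> [n|] [m|] // nm.
- exists [set Some n]; split => //; first exact: clopen_Some.
  by move=> mn; rewrite mn eqxx in nm.
- by exists [set Some n]; split => //; exact: clopen_Some.
- exists (~` [set Some m]); split => //; last by apply.
  exact: (clopenC setT (clopen_Some m)).
Qed.

Definition natoo_cg : cgType :=
  CGType (compact_hausdorff_k_space one_point_compactification_compact
            (zero_dimensional_hausdorff natoo_zero_dimensional))
    (hausdorff_weak_hausdorff
       (zero_dimensional_hausdorff natoo_zero_dimensional)).

(** * The semigroup law *)

(** The two retractions of the positive integers onto the odd ones: [false]
  sends an even number to its predecessor, [true] to its successor. *)
Definition odd_retract (j : bool) (n : nat) : nat :=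
  if n is m.+1 then ((j + m)./2).*2.+1 else 0.

Definition mul (x y : option nat) : option nat :=
  omap (odd_retract (y == Some 0%N)) x.

Lemma odd_retract_eq0 j n : (odd_retract j n == 0)%N = (n == 0)%N.
Proof. by case: n. Qed.

(** Both retractions have the same image and fix it pointwise. Together with [mul_eq0], this gives
    associativity: both bracketings apply to [x] the retraction chosen by [y]. *)
Lemma odd_retractK i j n : odd_retract i (odd_retract j n) = odd_retract j n.
Proof. by case: n => //= n; rewrite half_bit_double. Qed.

Lemma mul_eq0 x y : (mul x y == Some 0%N) = (x == Some 0%N).
Proof. by case: x => //= n; rewrite /eq_op/= odd_retract_eq0. Qed.

Lemma mul_assoc : associative mul.
Proof.
move=> x y z; rewrite /mul -/(mul y z) mul_eq0.
by case: x => //= n; rewrite odd_retractK.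
Qed.

Lemma mul_compatible_const (Z : Type) (phi : option nat -> Z) (n : nat) :
  (forall x y, phi x = phi (mul x y)) -> phi (Some n.+1) = phi (Some 1%N).
Proof.
(* Multiplying by [None] rounds down to an odd number; the induction then climbs from 2k+1 to 2k+3
   through 2k+2, whose products with [None] and [Some 0] are these two. *)
move=> phiM; rewrite (phiM _ None) /=; elim: n./2 => //= k <-.
have := phiM (Some k.*2.+2) (Some 0%N).
by rewrite (phiM (Some k.*2.+2) None) /= uphalf_double doubleK => ->.
Qed.

(** The right factor matters only through a test that is locally constant, as [Some 0] is clopen; it
    remains to see that each retraction is continuous at infinity. *)
Lemma mul_continuous :
  continuous (fun p : natoo * natoo => mul p.1 p.2 : natoo).
Proof.
have rC j : continuous (omap (odd_retract j) : natoo -> natoo).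
  apply: natoo_continuous => U /nbhs_infty[UN [N _ NU]].
  (* The threshold is [N.+1] because a retraction lowers a number by at most one. *)
  apply/nbhs_infty; split => //; exists N.+1 => // -[//|n] /= Nn.
  apply: NU => /=; apply: leq_trans (leq_trans (Nn : (N <= n)%N) _) _.
    exact: (leq_addl j n).
  by rewrite -{1}(odd_double_half (j + n)); case: odd => //=.
move=> [x y] U /= /(rC (y == Some 0%N) x) nU.
have nB : nbhs (y : natoo) [set z | (z == Some 0%N) = (y == Some 0%N)].
  have [->|y0] := eqVneq y (Some 0%N); first exact: nbhs_Some.
  apply: (@filterS natoo (nbhs y) _ (~` [set Some 0%N])).
    by move=> z /= /eqP/negPf.
  apply: open_nbhs_nbhs; split; last exact/eqP.
  by apply: closed_openC; case: (clopen_Some 0).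
exists ((omap (odd_retract (y == Some 0%N)) : natoo -> natoo) @^-1` U,
        [set z : natoo | (z == Some 0%N) = (y == Some 0%N)]) => //.
by move=> [x' y'] [/= Ux' yE]; rewrite /mul yE.
Qed.

(** * Maps from cubes to zero-dimensional spaces *)

Lemma star_continuous_const (R : realType) (V : normedModType R)
    (T : topologicalType) (A : set V) (f : V -> T) (v w : V) :
  zero_dimensional T ->
  (forall t x, 0 <= t <= 1 -> A x -> A (t *: x)) ->
  {within A, continuous f} -> A v -> A w -> f v = f w.
Proof.
move=> T0 starA cf.
suff f0 u : A u -> f u = f 0 by move=> /f0-> /f0->.
(* The radial segment from 0 to [u] stays in [A], so its image is connected, hence a point. *)
move=> Au; pose g t : V := t *: u.
have cg : continuous g.
  by move=> t; apply: continuousZr_tmp.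
have gA : g @` `[0, 1] `<=` A.
  by move=> _ [t /= t01 <-]; apply: starA; rewrite // -in_itv/=.
have cgI : connected (g @` `[0, 1]).
  apply: connected_continuous_connected; last exact: continuous_subspaceT.
  exact: segment_connected.
have cI := connected_continuous_connected cgI (continuous_subspaceW gA cf).
apply: (zero_dimensional_connected T0 cI).
- by exists u => //; exists 1; rewrite /= ?in_itv/= ?lexx ?ler01// /g scale1r.
- by exists 0 => //; exists 0; rewrite /= ?in_itv/= ?lexx ?ler01// /g scale0r.
Qed.

Lemma cube_star (R : realType) n (t : R) (v : 'rV[R]_n) :
  0 <= t <= 1 -> cube v -> cube (t *: v).
Proof.
move=> /andP[t0 t1] cv i; have /andP[v0 v1] := cv i.
by rewrite mxE mulr_ge0//= mulr_ile1.
Qed.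

Lemma within_cube_const (R : realType) n (T : topologicalType)
    (f : 'rV[R]_n -> T) (v w : 'rV[R]_n) :
  zero_dimensional T -> {within @cube R n, continuous f} ->
  cube v -> cube w -> f v = f w.
Proof.
by move=> T0; apply: star_continuous_const T0 _ => t x; exact: cube_star.
Qed.

Lemma cube0 (R : realType) n : cube (0 : 'rV[R]_n).
Proof. by move=> i; rewrite mxE lexx ler01. Qed.

Lemma cube_boundary0 (R : realType) n :
  (0 < n)%N -> cube_boundary (0 : 'rV[R]_n).
Proof.
case: n => // n _; split; first exact: cube0.
by exists ord0; left; rewrite mxE.
Qed.

(** * Path components and their invariance *)

Lemma joined_zero_dimensional (R : realType) (T : topologicalType) (x y : T) :
  zero_dimensional T -> joined R x y -> x = y.
Proof.
move=> T0 [c [cc <- <-]].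
apply: (zero_dimensional_connected (A := c @` `[0, 1]) T0).
- by apply: connected_continuous_connected => //; exact: segment_connected.
- by exists 0; rewrite //= in_itv/= lexx ler01.
- by exists 1; rewrite //= in_itv/= lexx ler01.
Qed.

Lemma joined_refl (R : realType) (T : topologicalType) (x : T) : joined R x x.
Proof.
exists (fun=> x); split => //.
by apply: continuous_subspaceT; exact: cst_continuous.
Qed.

Lemma within_continuous_reparam (U V T : topologicalType) (A : set U)
    (B : set V) (h : U -> V) (f : V -> T) :
  continuous h -> (forall x, A x -> B (h x)) ->
  {within B, continuous f} -> {within A, continuous (f \o h)}.
Proof.
move=> ch hAB /subspace_continuousP cf; apply/subspace_continuousP => x Ax W.
move=> /(cf (h x) (hAB x Ax)) /ch BW.
suff : nbhs x [set y | A y -> W (f (h y))] by [].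
have {}BW : nbhs x [set y | B (h y) -> W (f (h y))] by [].
by refine (filterS _ BW) => y /= + /hAB; apply.
Qed.

Lemma joined_sym (R : realType) (T : topologicalType) (x y : T) :
  joined R x y -> joined R y x.
Proof.
move=> [c [cc c0 c1]]; exists (c \o (fun t => 1 - t)); split => /=.
- apply: within_continuous_reparam cc => t.
    by apply: cvgB; [exact: cvg_cst|exact: cvg_id].
  rewrite /= !in_itv/= => /andP[t0 t1]; lra.
- by rewrite subr0.
- by rewrite subrr.
Qed.

Lemma joined_trans (R : realType) (T : topologicalType) (x y z : T) :
  joined R x y -> joined R y z -> joined R x z.
Proof.
move=> [c [cc c0 c1]] [d [cd d0 d1]].
exists (fun t => if t <= 2^-1 then c (2 * t) else d (2 * t - 1)); split.
- rewrite (_ : `[0, 1]%classic = `[0, 2^-1] `|` `[2^-1, 1 : R]); last first.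
    apply/seteqP; split => t /=; rewrite !in_itv/=.
      by move=> /andP[t0 t1]; have [?|?] := lerP t 2^-1; [left|right]; lra.
    by move=> []/andP[t0 t1]; lra.
  apply: withinU_continuous; try exact: itv_closed.
    apply: (@subspace_eq_continuous _ _ _ (c \o *%R 2)).
      by move=> t; rewrite inE/= in_itv/= /from_subspace/= => /andP[_ ->].
    apply: within_continuous_reparam cc => t.
      by apply: cvgM; [exact: cvg_cst|exact: cvg_id].
    rewrite /= !in_itv/= => /andP[t0 t1]; lra.
  apply: (@subspace_eq_continuous _ _ _ (d \o (fun t => 2 * t - 1))).
    move=> t; rewrite inE/= in_itv/= /from_subspace/= => /andP[t0 t1].
    (* Both formulas must agree at the common endpoint 1/2, where the first one is in force. *)
    case: ifPn => // t2; have -> : t = 2^-1 by lra.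
    by rewrite divff// subrr d0 c1.
  apply: within_continuous_reparam cd => t.
    apply: cvgB; last exact: cvg_cst.
    by apply: cvgM; [exact: cvg_cst|exact: cvg_id].
  rewrite /= !in_itv/= => /andP[t0 t1]; lra.
- by rewrite ifT ?mulr0//; lra.
- by rewrite ifF ?mulr1//; [rewrite (_ : 2 - 1 = 1 :> R)//|]; lra.
Qed.

Lemma joined_image (R : realType) (T U : topologicalType) (f : T -> U)
    (x y : T) :
  continuous f -> joined R x y -> joined R (f x) (f y).
Proof.
move=> cf [c [cc c0 c1]]; exists (f \o c); split; rewrite /= ?c0 ?c1//.
by move=> t; exact: (continuous_comp (cc t) (cf (c t))).
Qed.

(** The invariant separating the two branching spaces. As a property of a single space, it passes
    along zigzags by mere logical equivalence. *)
Definition at_most_two_path_components (R : realType) (T : topologicalType) :=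
  exists x y : T, forall z, joined R z x \/ joined R z y.

Lemma whe_path_components (R : realType) (X Y : topologicalType) (f : X -> Y) :
  weak_homotopy_equivalence R f ->
  at_most_two_path_components R X <-> at_most_two_path_components R Y.
Proof.
move=> [cf finj fsurj _ _]; split=> [[x [y xyP]]|[x [y xyP]]].
  exists (f x), (f y) => z; have [a /joined_sym az] := fsurj z.
  by have [] := xyP a => /(joined_image cf) H; [left|right];
    exact: joined_trans az H.
have [a ax] := fsurj x; have [b bY] := fsurj y.
exists a, b => z; have [] := xyP (f z) => H; [left|right]; apply: finj.
  exact: joined_trans H (joined_sym ax).
exact: joined_trans H (joined_sym bY).
Qed.

Lemma weakly_homotopy_equivalent_path_components (R : realType) (X Y : cgType) :
  weakly_homotopy_equivalent R X Y ->
  at_most_two_path_components R X <-> at_most_two_path_components R Y.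
Proof.
elim=> [{}X {}Y [f]|{}X|{}X {}Y _ [XY YX]|{}X {}Y Z _ [XY YX] _ [YZ ZY]] //.
  exact: whe_path_components.
by split=> [/XY/YZ|/ZY/YX].
Qed.

(** * Weak equivalences of zero-dimensional spaces *)

Lemma spheroid_zero_dimensional (R : realType) n (T : topologicalType) (x : T)
    (a : 'rV[R]_n -> T) (v : 'rV[R]_n) :
  zero_dimensional T -> (0 < n)%N -> spheroid x a -> cube v -> a v = x.
Proof.
move=> T0 n0 [ca ax] cv.
rewrite (within_cube_const T0 ca cv (@cube0 R n)) ax//.
exact: cube_boundary0.
Qed.

(** Paths and spheroids are constant, so only the bijection on points remains. The inverse may be
    discontinuous, which allows a discrete space to be compared with a compact one. *)
Lemma zero_dimensional_whe (R : realType) (X Y : topologicalType) (f : X -> Y) :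
  zero_dimensional X -> zero_dimensional Y -> continuous f -> bijective f ->
  weak_homotopy_equivalence R f.
Proof.
move=> X0 Y0 cf [g fK gK]; split=> //.
- move=> x x' /(joined_zero_dimensional Y0)/(can_inj fK) ->.
  exact: joined_refl.
- by move=> y; exists (g y); rewrite gK; exact: joined_refl.
- move=> n x a b n0 sa sb _; exists (fun=> x); split => //.
  + by apply: continuous_subspaceT; exact: cst_continuous.
  + by move=> v cv; rewrite (spheroid_zero_dimensional X0 n0 sa cv).
  + by move=> v cv; rewrite (spheroid_zero_dimensional X0 n0 sb cv).
- move=> n x b n0 sb; exists (fun=> x).
    by split => //; apply: continuous_subspaceT; exact: cst_continuous.
  exists (fun=> f x); split => //.
  + by apply: continuous_subspaceT; exact: cst_continuous.
  + by move=> v cv; rewrite (spheroid_zero_dimensional Y0 n0 sb cv).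
Qed.

(** * The two flows and their branching spaces *)

Lemma mul_discrete_continuous :
  continuous (fun p : discrete_cg (option nat) * discrete_cg (option nat) =>
    mul p.1 p.2 : discrete_cg (option nat)).
Proof.
move=> [x y] U /nbhs_singleton Uxy.
exists ([set x], [set y]); first by split; exact: discrete_set1.
by move=> [x1 y1] [/= -> ->].
Qed.

Definition discrete_flow : flow :=
  semigroup_flow mul_discrete_continuous mul_assoc.

Definition compact_flow : flow :=
  @semigroup_flow natoo_cg mul mul_continuous mul_assoc.

Definition comparison : flow_morphism discrete_flow compact_flow :=
  @FlowMorphism discrete_flow compact_flow id id
    (@discrete_continuous (discrete_topology (option nat)) natoo id)
    (fun=> erefl) (fun=> erefl) (fun _ _ _ _ => erefl).

Lemma comparison_whe (R : realType) : weak_S_homotopy_equivalence R comparison.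
Proof.
split; first by exists id.
apply: zero_dimensional_whe; last by exists id.
- exact: discrete_zero_dimension.
- exact: natoo_zero_dimensional.
- exact: on_paths_continuous.
Qed.

(** [Some true] is the class of 0, [Some false] that of the positive integers, and [None] that of
    infinity. *)
Definition discrete_branching (x : option nat) : discrete_cg (option bool) :=
  omap (eq_op^~ 0%N) x.

Definition compact_branching (x : option nat) : discrete_cg bool :=
  x == Some 0%N.

Lemma discrete_branchingP :
  @is_branching_space discrete_flow _ discrete_branching.
Proof.
split=> [|[n|] y _ //=|Z phi cphi phiM].
- exact: discrete_continuous.
- by rewrite /discrete_branching /= odd_retract_eq0.
have phi1 n : phi (Some n.+1) = phi (Some 1%N).
  by apply: mul_compatible_const => x y; exact: phiM.
exists (fun b : option bool =>
  if b is Some b then if b then phi (Some 0%N) else phi (Some 1%N)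
  else phi None).
split.
  split; first exact: discrete_continuous.
  by apply/funext => -[[|n]|] //=; rewrite phi1.
by move=> g [_ gE]; apply/funext => -[[]|]; rewrite -gE.
Qed.

Lemma compact_branchingP :
  @is_branching_space compact_flow _ compact_branching.
Proof.
split=> [|x y h|Z phi cphi phiM].
- apply: natoo_continuous => U /nbhs_singleton UN.
  by apply/nbhs_infty; split => //; exists 1 => // -[].
- by rewrite /compact_branching mul_eq0.
have phi1 n : phi (Some n.+1) = phi (Some 1%N).
  by apply: mul_compatible_const => x y; exact: phiM.
(* The positive integers accumulate at infinity and [phi] sends them all to one closed point, so
   continuity forces the same value at infinity. *)
have phiN : phi None = phi (Some 1%N).
  have cl : closed [set phi (Some 1%N)].
    exact: (weak_hausdorff_closed1 (@cg_weak_hausdorff Z)).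
  apply: (@preimage_closed _ _ phi) cl None _ => [x _|U]; first exact: cphi.
  move=> /nbhs_infty[_ [N _ NU]]; exists (Some N.+1); split.
    exact: phi1.
  by apply: NU => /=.
exists (fun b : bool => if b then phi (Some 0%N) else phi (Some 1%N)).
split.
  split; first exact: discrete_continuous.
  by apply/funext => -[[|n]|] //=; rewrite phi1.
by move=> g [_ gE]; apply/funext => -[]; rewrite -gE.
Qed.

Theorem theorem4p1 (R : realType) :
  exists (X Y : flow) (f : flow_morphism X Y)
         (BX BY : cgType) (hX : paths X -> BX) (hY : paths Y -> BY),
    [/\ weak_S_homotopy_equivalence R f,
        is_branching_space hX,
        is_branching_space hY &
        ~ weakly_homotopy_equivalent R BX BY].
Proof.
exists discrete_flow, compact_flow, comparison, _, _, discrete_branching,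
  compact_branching.
split; [exact: comparison_whe|exact: discrete_branchingP|
        exact: compact_branchingP|].
(* The property holds for [bool] and would transfer back to the discrete space [option bool]. *)
move=> /weakly_homotopy_equivalent_path_components[_].
case.
  by exists true, false => -[]; [left|right]; exact: joined_refl.
move=> x [y xyP].
have {}xyP z : z = x \/ z = y.
  by have [] := xyP z => /(joined_zero_dimensional discrete_zero_dimension) ->;
    [left|right].
(* Pigeonhole: three distinct points cannot all lie in the pair [x], [y]. *)
have := (xyP None, xyP (Some true), xyP (Some false)).
by case=> [[[<-|<-] [+|+]] [+|+]] => // <-.
Qed.
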